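(* Let $R$ be a commutative ring containing $\mathbb{Q}$, let $\mathbf{k}=(k_1,\dots,k_m)$ be a tuple of positive integers of weight $w=k_1+\cdots+k_m$, and let $N$ be a positive integer. Put $l_1=k_m$, $l_2=k_m+k_{m-1}$, $\dots$, $l_m=k_m+\cdots+k_1=w$. Then the following identities hold in $R[t_1,t_2^{\pm1},\dots,t_m^{\pm1}]$: $$\sum_{N+1>n_1>\cdots>n_m>0}(-1)^{n_m}\binom{N}{n_m}\frac{(t_1/t_2)^{n_1}\cdots(t_{m-1}/t_m)^{n_{m-1}}t_m^{n_m}}{n_1^{k_1}\cdots n_m^{k_m}}$$ $$=(-1)^{m-1}\sum_{N\ge n_1\ge\cdots\ge n_w\ge1}\frac{(1-t_m)^{n_{l_1}-n_{l_1+1}}\cdots(1-t_2)^{n_{l_{m-1}}-n_{l_{m-1}+1}}\{(1-t_1)^{n_{l_m}}-1\}}{n_1\cdots n_w}$$ $$+\sum_{j=1}^{m-1}(-1)^{m-j-1}\left(\sum_{N+1>n_1>\cdots>n_j>0}\frac{(t_1/t_2)^{n_1}\cdots(t_j/t_{j+1})^{n_j}}{n_1^{k_1}\cdots n_j^{k_j}}\right)$$ $$\times\left(\sum_{N\ge n_1\ge\cdots\ge n_{l_{m-j}}\ge1}\frac{(1-t_m)^{n_{l_1}-n_{l_1+1}}\cdots(1-t_{j+2})^{n_{l_{m-j-1}}-n_{l_{m-j-1}+1}}\{(1-t_{j+1})^{n_{l_{m-j}}}-1\}}{n_1\cdots n_{l_{m-j}}}\right),$$ and $$\sum_{N+1>n_1>\cdots>n_m>0}\frac{(t_1/t_2)^{n_1}\cdots(t_{m-1}/t_m)^{n_{m-1}}t_m^{n_m}}{n_1^{k_1}\cdots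 n_m^{k_m}}$$ $$=(-1)^{m-1}\sum_{N\ge n_1\ge\cdots\ge n_w\ge1}(-1)^{n_1}\binom{N}{n_1}\frac{(1-t_m)^{n_{l_1}-n_{l_1+1}}\cdots(1-t_2)^{n_{l_{m-1}}-n_{l_{m-1}+1}}\{(1-t_1)^{n_{l_m}}-1\}}{n_1\cdots n_w}$$ $$+\sum_{j=1}^{m-1}(-1)^{m-j-1}\left(\sum_{N+1>n_1>\cdots>n_j>0}\frac{(t_1/t_2)^{n_1}\cdots(t_j/t_{j+1})^{n_j}}{n_1^{k_1}\cdots n_j^{k_j}}\right)$$ $$\times\left(\sum_{N\ge n_1\ge\cdots\ge n_{l_{m-j}}\ge1}(-1)^{n_1}\binom{N}{n_1}\frac{(1-t_m)^{n_{l_1}-n_{l_1+1}}\cdots(1-t_{j+2})^{n_{l_{m-j-1}}-n_{l_{m-j-1}+1}}\{(1-t_{j+1})^{n_{l_{m-j}}}-1\}}{n_1\cdots n_{l_{m-j}}}\right).$$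
   Context: All summation variables $n_i$ are integers; a zeroth power is the constant $1$; empty sums are $0$ and empty products are $1$ (in particular for $j=m-1$ the second factor is $\sum_{N\ge n_1\ge\cdots\ge n_{l_1}\ge 1}\frac{(1-t_m)^{n_{l_1}}-1}{n_1\cdots n_{l_1}}$, respectively the same with the factor $(-1)^{n_1}\binom{N}{n_1}$). *)

(* Defs.v *)
From HB Require Import structures.
From mathcomp Require Import all_boot all_order all_algebra.
From mathcomp Require Import ring_quotient generic_quotient.
From mathcomp Require Import boolp.
From mathcomp Require Export mpoly.

Set Implicit Arguments.
Unset Strict Implicit.
Unset Printing Implicit Defensive.

Import GRing.Theory.
Local Open Scope ring_scope.
Local Open Scope quotient_scope.

(* The ring R[t_1, t_2^{+-1}, ..., t_m^{+-1}] for m >= 1, presented as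
     R[t_1, ..., t_m, s_2, ..., s_m] / (t_i s_i - 1 : 2 <= i <= m).
   MathComp has no Laurent polynomials, and the monoid algebras of monalg.v
   exclude exponent monoids with nontrivial units. Below p stands for m - 1. *)
Section LaurentIdeal.
Variables (R : comNzRingType) (p : nat).

Definition tX (i : 'I_p.+1) : {mpoly R[p.+1 + p]} := 'X_(lshift p i).
Definition sX (j : 'I_p) : {mpoly R[p.+1 + p]} := 'X_(rshift p.+1 j).

(* lift ord0 j is the index j + 1, so this is t_{j+2} s_{j+2} - 1 when t_1 is
   the variable of index 0. *)
Definition lrel (j : 'I_p) : {mpoly R[p.+1 + p]} :=
  tX (lift ord0 j) * sX j - 1.

Definition lideal : {pred {mpoly R[p.+1 + p]}} := fun f =>
  `[< exists a : 'I_p -> {mpoly R[p.+1 + p]}, f = \sum_j a j * lrel j >].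

Lemma lideal_closed : idealr_closed lideal.
Proof.
split.
- by apply/asboolP; exists (fun=> 0); rewrite big1 // => j _; rewrite mul0r.
- apply/asboolP => -[a /(congr1 (meval (fun=> 1)))].
  rewrite rmorph1 rmorph_sum /= big1 => [/eqP|j _]; first by rewrite oner_eq0.
  by rewrite rmorphM rmorphB rmorphM rmorph1 /= !mevalXU mul1r subrr mulr0.
- move=> c u v /asboolP[a ->] /asboolP[b ->]; apply/asboolP.
  exists (fun j => c * a j + b j); rewrite mulr_sumr -big_split /=.
  by apply: eq_bigr => j _; rewrite mulrDl mulrA.
Qed.

HB.instance Definition _ :=
  isIdealr.Build {mpoly R[p.+1 + p]} lideal lideal_closed.

Definition lquot : Type := {ideal_quot lideal}.

HB.instance Definition _ := GRing.ComNzRing.on lquot.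

Definition lunit : {pred lquot} := fun x => `[< exists y, y * x = 1 >].

Definition linv (x : lquot) : lquot :=
  if pselect (exists y, y * x = 1) is left e then projT1 (cid e) else x.

Lemma lmulVr : {in lunit, left_inverse 1 linv *%R}.
Proof.
by move=> x /asboolP ux; rewrite /linv; case: pselect => // e; case: cid.
Qed.

Lemma lunitP (x y : lquot) : y * x = 1 -> x \in lunit.
Proof. by move=> yx; apply/asboolP; exists y. Qed.

Lemma linv_out : {in [predC lunit], linv =1 id}.
Proof.
by move=> x /asboolP ux; rewrite /linv; case: pselect.
Qed.

HB.instance Definition _ :=
  GRing.ComNzRing_hasMulInverse.Build lquot lmulVr lunitP linv_out.

Definition lpi (f : {mpoly R[p.+1 + p]}) : lquot := \pi_{ideal_quot lideal} f.

Lemma lpi1 : lpi 1 = 1.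
Proof. by rewrite /lpi rmorph1. Qed.

Lemma lpiD : {morph lpi : f g / f + g}.
Proof. by move=> f g; rewrite /lpi rmorphD. Qed.

Lemma lpiM : {morph lpi : f g / f * g}.
Proof. by move=> f g; rewrite /lpi rmorphM. Qed.

Lemma lpi_ts (j : 'I_p) : lpi (tX (lift ord0 j)) * lpi (sX j) = 1.
Proof.
rewrite -lpiM -lpi1; apply/eqP; rewrite /lpi -Quotient.idealrBE.
apply/asboolP; exists (fun i => (i == j)%:R).
rewrite (bigD1 j) //= eqxx mul1r big1 ?addr0 // => i /negPf ->.
by rewrite mul0r.
Qed.

End LaurentIdeal.

Section LaurentRing.
Variables (R : comAlgType rat) (m : nat).

Definition laurent : comUnitRingType := lquot R m.-1.

(* t_i, for 1 <= i <= m. *)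
Definition tvar (i : nat) : laurent := lpi (tX R (inord i.-1 : 'I_m.-1.+1)).

Definition ratC (q : rat) : laurent := lpi (q%:A)%:MP.

Lemma tvar_unit i : (1 < i <= m)%N -> tvar i \is a GRing.unit.
Proof.
case/andP=> i1 im; have ltj : (i.-2 < m.-1)%N.
  by case: i i1 im => [|[|i]] //= _; case: m.
pose j := Ordinal ltj.
have -> : tvar i = lpi (tX R (lift ord0 j)).
  congr (lpi (tX R _)); apply/val_inj; rewrite /= inordK.
    by case: i i1 {im ltj j} => [|[|i]].
  by case: i i1 im {ltj j} => [|[|i]] //= _; case: m.
by apply/unitrP; exists (lpi (sX R j)); rewrite mulrC lpi_ts.
Qed.

End LaurentRing.

(* A summation index (n_1, ..., n_l) is an l-tuple over 'I_N.+1, read as a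
   sequence of naturals through idx; s`_[i] is the i-th entry, 1 <= i. *)
Definition ent (s : seq nat) (i : nat) : nat := nth 0%N s i.-1.
Notation "s '`_[' i ]" := (ent s i)
  (at level 2, left associativity, format "s '`_[' i ]").

Definition idx (l N : nat) (n : l.-tuple 'I_N.+1) : seq nat :=
  [seq nat_of_ord x | x <- n].

(* N + 1 > n_1 > ... > n_l > 0 *)
Definition strict_chain (N : nat) (s : seq nat) : bool :=
  path gtn N.+1 (rcons s 0%N).

(* N >= n_1 >= ... >= n_l >= 1 *)
Definition weak_chain (N : nat) (s : seq nat) : bool :=
  path geq N (rcons s 1%N).

(* l_i = k_m + k_{m-1} + ... + k_{m-i+1} *)
Definition lpart (m : nat) (k : seq nat) (i : nat) : nat :=
  \sum_(0 <= r < i) k`_[m - r].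

Lemma lpart_weight (m : nat) (k : m.-tuple nat) : lpart m k m = sumn k.
Proof.
rewrite /lpart sumnE [RHS](big_nth 0%N) size_tuple big_nat_rev /= add0n.
by apply: eq_big_nat => i /andP[_ im]; rewrite /ent subKn.
Qed.

Section Summands.
Variables (R : comAlgType rat) (m : nat).
Local Notation t := (@tvar R m).

(* prod_{i <= j} (t_i / t_{i+1})^{n_i} / (n_1^{k_1} ... n_j^{k_j}) *)
Definition ratio_term (k : seq nat) (j : nat) (n : seq nat) : laurent R m :=
  (\prod_(1 <= i < j.+1) (t i / t i.+1) ^+ n`_[i])
  * ratC R m (\prod_(1 <= i < j.+1) (n`_[i] ^ k`_[i])%:R)^-1.

(* prod_{i < m} (t_i / t_{i+1})^{n_i} * t_m^{n_m} / (n_1^{k_1} ... n_m^{k_m}) *)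
Definition full_term (k : seq nat) (n : seq nat) : laurent R m :=
  (\prod_(1 <= i < m) (t i / t i.+1) ^+ n`_[i]) * t m ^+ n`_[m]
  * ratC R m (\prod_(1 <= i < m.+1) (n`_[i] ^ k`_[i])%:R)^-1.

(* With l_i = lpart m k i and 1 <= q <= m:
   (1 - t_m)^{n_{l_1} - n_{l_1 + 1}} ...
     (1 - t_{m-q+2})^{n_{l_{q-1}} - n_{l_{q-1} + 1}}
     {(1 - t_{m-q+1})^{n_{l_q}} - 1} / (n_1 ... n_{l_q}).
   The natural-number subtractions are exact on weakly decreasing n. *)
Definition star_term (k : seq nat) (q : nat) (n : seq nat) : laurent R m :=
  (\prod_(1 <= i < q)
     (1 - t (m.+1 - i)) ^+ (n`_[lpart m k i] - n`_[(lpart m k i).+1]))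
  * ((1 - t (m.+1 - q)) ^+ n`_[lpart m k q] - 1)
  * ratC R m (\prod_(1 <= i < (lpart m k q).+1) (n`_[i])%:R)^-1.

End Summands.

(* Main.v *)
Require Import Defs.
From HB Require Import structures.
From mathcomp Require Import all_boot all_order all_algebra.

Set Implicit Arguments.
Unset Strict Implicit.
Unset Printing Implicit Defensive.

Import GRing.Theory.
Local Open Scope ring_scope.

(** Two independent facts combine to give the theorem.

The first is a duality under the binomial transform T, which sends f to
  (T f)(n) = sum over 1 <= k <= n of (-1)^k C(n, k) f(k).
Let E_c f(n) be the sum over 1 <= b <= n of c^(n-b) f(b) / b. Then
T E_d = E_(1-d) T (bintrans_geomsum). A weak chain sum with weights
(1 - t)^(n_i - n_(i+1)) is a composite of operators E_1 and E_(1-t) applied to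
(1 - t)^n - 1, and the latter is T of t^n. Its transform is therefore the
corresponding composite of E_0 and E_t applied to t^n. Since E_0 is mere division
by n, each block of k_i indices collapses to a single index with denominator
n^(k_i): transforming the sums over w indices on the right-hand side leaves sums
over m indices (dual_nest, star_chsum).

The second is inclusion-exclusion between strict and weak chains. Put
x_i(n) = (t_i / t_(i+1))^n / n^(k_i), and let A_p(n) be the sum of
x_1(n_1) ... x_p(n_p) over N >= n_1 > ... > n_p > n. Complementing the condition
n_p > n gives A_p(n) = A_p(0) - sum over 1 <= r <= n of x_p(r) A_(p-1)(r).
Iterating this expresses A_p(n) as an alternating sum over j of A_j(0) times a
weak chain sum below n, which is exactly a collapsed sum of the first part, the
powers of t_2, ..., t_m telescoping (strict_pow_density).

Summing over the smallest index n = n_m against a weight phi gives both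
identities at once: phi(n) = (-1)^n C(N, n) for one and phi(n) = 1 for the other.
On the weak side these become the weights 1 and (-1)^n C(N, n) of the largest
index, because T exchanges them (sum_dual). *)

(** * The binomial transform and weighted summation *)

Section BinomialDuality.
Variable A : comUnitRingType.

Definition geomsum (c : A) (f : nat -> A) (n : nat) : A :=
  \sum_(1 <= b < n.+1) c ^+ (n - b) * (f b / b%:R).

Definition bintrans (f : nat -> A) (n : nat) : A :=
  \sum_(1 <= k < n.+1) (-1) ^+ k * 'C(n, k)%:R * f k.

(** Values at 0 are left out since they differ from the transform in the dual pair
c^n - 1, d^n. *)
Definition bin_dual (f g : nat -> A) : Prop :=
  forall n, (0 < n)%N -> g n = bintrans f n.

Lemma geomsumS c f n :
  geomsum c f n.+1 = c * geomsum c f n + f n.+1 / n.+1%:R.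
Proof.
rewrite /geomsum big_nat_recr //= subnn mul1r mulr_sumr; congr (_ + _).
by apply: eq_big_nat => b /andP[_ bn]; rewrite subSn // exprS -mulrA.
Qed.

Lemma geomsum0 c f : geomsum c f 0 = 0.
Proof. by rewrite /geomsum big_geq. Qed.

Lemma eq_geomsum c f g n : (forall b, (0 < b <= n)%N -> f b = g b) ->
  geomsum c f n = geomsum c g n.
Proof. by move=> fg; apply: eq_big_nat => b bn; rewrite fg. Qed.

Lemma geomsum_0 f n : (0 < n)%N -> geomsum 0 f n = f n / n%:R.
Proof. by case: n => // n _; rewrite geomsumS mul0r add0r. Qed.

Lemma bintrans_full f n : f 0 = 0 ->
  bintrans f n = \sum_(k < n.+1) (-1) ^+ k * 'C(n, k)%:R * f k.
Proof.
move=> f0; rewrite -(big_mkord xpredT (fun k => (-1) ^+ k * 'C(n, k)%:R * f k)).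
by rewrite big_ltn // f0 mulr0 add0r.
Qed.

Lemma dual_expr (c d : A) : c + d = 1 ->
  bin_dual (fun n => c ^+ n) (fun n => d ^+ n - 1).
Proof.
move=> cd n _; have -> : d = 1 - c by rewrite -cd addrC addKr.
rewrite exprBn /bintrans -(big_mkord xpredT (fun i =>
   ((-1) ^+ i * 1 ^+ (n - i) * c ^+ i) *+ 'C(n, i))) big_ltn //.
rewrite !expr0 expr1n !mulr1 bin0 mulr1n addrC addKr.
by apply: eq_bigr => i _; rewrite expr1n mulr1 -mulr_natr mulrAC.
Qed.

Lemma bintransB f g n :
  bintrans (fun k => f k - g k) n = bintrans f n - bintrans g n.
Proof.
by rewrite /bintrans -sumrB; apply: eq_bigr => k _; rewrite mulrBr.
Qed.

(** This is dual_expr read backwards, proved from it by linearity: the constant 1 is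
dual to 0^n - 1 = -1. *)
Lemma dual_exprB1 (c d : A) : c + d = 1 ->
  bin_dual (fun n => c ^+ n - 1) (fun n => d ^+ n).
Proof.
move=> cd n n0; rewrite bintransB -(dual_expr cd) //.
have -> : bintrans (fun=> 1) n = bintrans (fun k => 1 ^+ k) n.
  by apply: eq_bigr => k _; rewrite expr1n.
rewrite -(@dual_expr 1 0) ?addr0 // expr0n gtn_eqF // sub0r opprK.
by rewrite subrK.
Qed.

Hypothesis natU : forall n, (0 < n)%N -> (n%:R : A) \is a GRing.unit.

Lemma bin_div n k :
  ('C(n, k)%:R : A) / k.+1%:R = 'C(n.+1, k.+1)%:R / n.+1%:R.
Proof.
apply: (mulIr (natU (ltn0Sn k))); rewrite divrK ?natU //.
apply: (mulIr (natU (ltn0Sn n))); rewrite mulrAC divrK ?natU //.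
by rewrite -!natrM mulnC (mul_bin_diag n.+1) mulnC.
Qed.

(** The summation operator is determined by the recurrence geomsumS, so it suffices
that the transform H of F = geomsum d f satisfies
H(n+1) = (1-d) H(n) + (bintrans f)(n+1) / (n+1). Pascal's rule writes
H(n+1) - H(n) as the sum of (-1)^k C(n, k-1) F(k); expanding F(k) by its own
recurrence gives -d H(n) and, by bin_div, the last term. *)
Lemma bintrans_geomsum d f n :
  bintrans (geomsum d f) n = geomsum (1 - d) (bintrans f) n.
Proof.
elim: n => [|n IH]; first by rewrite geomsum0 /bintrans big_geq.
rewrite geomsumS -IH !(bintrans_full _ (geomsum0 _ _)).
set F := geomsum d f.
rewrite big_ord_recl /= {1}/F geomsum0 mulr0 add0r.
transitivity (\sum_(k < n.+1) (-1) ^+ k.+1 * 'C(n, k.+1)%:R * F k.+1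
            + \sum_(k < n.+1) (-1) ^+ k.+1 * 'C(n, k)%:R * F k.+1).
  rewrite -big_split /=; apply: eq_bigr => k _.
  by rewrite /bump /= add1n binS natrD -mulrDl -mulrDr.
rewrite mulrBl mul1r -addrA; congr (_ + _).
  rewrite big_ord_recr /= bin_small // mulr0 mul0r addr0.
  by rewrite [RHS]big_ord_recl /F geomsum0 mulr0 add0r.
rewrite mulr_sumr mulr_suml -sumrN.
rewrite (big_addn 0 n.+2 1) subn1 /= big_mkord -big_split /=.
apply: eq_bigr => k _; rewrite addn1 /F geomsumS mulrDr; congr (_ + _).
  by rewrite exprS mulN1r !mulNr; congr (- _); rewrite mulrCA.
rewrite -mulrA [_ * (f _ / _)]mulrCA bin_div.
by rewrite -!mulrA; congr (_ * _); rewrite mulrCA.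
Qed.

Lemma dual_geomsum c d f g : c + d = 1 -> bin_dual f g ->
  bin_dual (geomsum c f) (geomsum d g).
Proof.
move=> cd fg n n0; have -> : d = 1 - c by rewrite -cd addrC addKr.
by rewrite bintrans_geomsum; apply: eq_geomsum => b /andP[b0 _]; apply: fg.
Qed.

(** Both sides are the same division by n, transported: summing g(n)/n is
geomsum 1, whose dual geomsum 0 is bare division. *)
Lemma sum_dual N f g : (0 < N)%N -> bin_dual f g ->
  \sum_(1 <= n < N.+1) g n / n%:R =
  \sum_(1 <= n < N.+1) (-1) ^+ n * 'C(N, n)%:R * (f n / n%:R).
Proof.
move=> N0 fg; transitivity (geomsum 1 g N).
  by apply: eq_bigr => n _; rewrite expr1n mul1r.
rewrite (dual_geomsum (add0r 1) fg) //.
by apply: eq_big_nat => n /andP[n0 _]; rewrite geomsum_0.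
Qed.

Section Nest.
Variable k : seq nat.

(** A nested sum over q + 1 blocks of indices, the outermost of size k_m, the next
of size k_(m-1), and so on: u weights the steps inside a block, s_m the step out
of block m, and h closes the innermost block. The outermost summation of block m
is left out (hence the predecessor), so that the caller may put any weight
there. *)
Fixpoint nest (u : A) (s : nat -> A) (h : A -> nat -> A) (q m : nat) :
    nat -> A :=
  iter (k`_[m]).-1 (geomsum u)
    (if q is q'.+1 then geomsum (s m) (nest u s h q' m.-1) else h (s m)).

Lemma dual_nest u v s r h g q m : u + v = 1 -> (forall i, s i + r i = 1) ->
  (forall c d, c + d = 1 -> bin_dual (h c) (g d)) ->
  bin_dual (nest u s h q m) (nest v r g q m).
Proof.
move=> uv sr hg; elim: q m => [|q IH] m /=.
  by elim: (_.-1) => [|x IHx] /=; [apply: hg | apply: dual_geomsum].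
elim: (_.-1) => [|x IHx] /=; last exact: dual_geomsum.
exact: dual_geomsum.
Qed.

End Nest.
End BinomialDuality.

(** * Sums over chains *)

Section ChainSums.
Variables (A : comUnitRingType) (N : nat).

(** The sum of F over the l-tuples n with a r n_1 r ... r n_l r z. Both kinds of
chain are of this form, and keeping the end points a and z as parameters allows
recursion from either end. *)
Definition chsum (r : rel nat) (z l a : nat) (F : seq nat -> A) : A :=
  \sum_(n : l.-tuple 'I_N.+1 | path r a (rcons (idx n) z)) F (idx n).

Lemma eq_chsum r z l a F G : (forall s, size s = l -> F s = G s) ->
  chsum r z l a F = chsum r z l a G.
Proof. by move=> FG; apply: eq_bigr => n _; rewrite FG // size_map size_tuple. Qed.

Lemma chsumZ r z l a c F : chsum r z l a (fun s => c * F s) = c * chsum r z l a F.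
Proof. by rewrite /chsum mulr_sumr. Qed.

Lemma chsum0 r z a F : chsum r z 0 a F = if r a z then F [::] else 0.
Proof.
rewrite /chsum big_mkcond (big_pred1 [tuple]) /= ?andbT //.
by move=> n; apply/esym/eqP; rewrite tuple0.
Qed.

Lemma big_tuple_cons (T : finType) l (P : pred (seq T)) (F : seq T -> A) :
  \sum_(n : l.+1.-tuple T | P n) F n =
  \sum_b \sum_(n : l.-tuple T | P (b :: n)) F (b :: n).
Proof.
rewrite pair_big_dep /= (reindex (fun p : T * l.-tuple T => cons_tuple p.1 p.2)) //=.
exists (fun n => (thead n, behead_tuple n)) => [[b n]|n] _ /=.
  by rewrite theadE; congr (_, _); apply: val_inj.
by rewrite [RHS]tuple_eta.
Qed.

Lemma big_tuple_rev (T : finType) l (P : pred (seq T)) (F : seq T -> A) :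
  \sum_(n : l.-tuple T | P n) F n =
  \sum_(n : l.-tuple T | P (rev n)) F (rev n).
Proof.
rewrite (reindex (fun n : l.-tuple T => rev_tuple n)) //=.
by exists (fun n => rev_tuple n) => n _; apply: val_inj; rewrite /= revK.
Qed.

Lemma big_tuple_rcons (T : finType) l (P : pred (seq T)) (F : seq T -> A) :
  \sum_(n : l.+1.-tuple T | P n) F n =
  \sum_b \sum_(n : l.-tuple T | P (rcons n b)) F (rcons n b).
Proof.
rewrite big_tuple_rev.
rewrite (big_tuple_cons _ (fun s => P (rev s)) (fun s => F (rev s))).
apply: eq_bigr => b _.
rewrite [RHS](big_tuple_rev _ (fun s => P (rcons s b)) (fun s => F (rcons s b))).
by apply: eq_big => [n|n _]; rewrite rev_cons.
Qed.

Lemma chsum_cons r z l a F :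
  chsum r z l.+1 a F =
  \sum_(b < N.+1 | r a b) chsum r z l b (fun s => F (nat_of_ord b :: s)).
Proof.
rewrite /chsum (big_tuple_cons _ (fun s => path r a
  (rcons [seq nat_of_ord x | x <- s] z)) (fun s => F [seq nat_of_ord x | x <- s])).
rewrite [RHS]big_mkcond; apply: eq_bigr => b _ /=.
by case: (r a b) => //=; rewrite big_pred0.
Qed.

Lemma chsum_rcons r z l a F :
  chsum r z l.+1 a F =
  \sum_(b < N.+1 | r b z) chsum r b l a (fun s => F (rcons s (nat_of_ord b))).
Proof.
rewrite /chsum (big_tuple_rcons _ (fun s => path r a
  (rcons [seq nat_of_ord x | x <- s] z)) (fun s => F [seq nat_of_ord x | x <- s])).
rewrite [RHS]big_mkcond; apply: eq_bigr => b _ /=.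
case: ifP => rbz; last first.
  by apply: big_pred0 => n; rewrite rcons_path map_rcons last_rcons rbz andbF.
apply: eq_big => [n|n _]; rewrite map_rcons //.
by rewrite [LHS]rcons_path last_rcons rbz andbT.
Qed.

Lemma chsum_geq0 l F : chsum geq 1 l 0 F = 0.
Proof.
apply: big_pred0 => n; apply/negP; rewrite path_sortedE; last first.
  by move=> x y w /= xy yw; apply: leq_trans yw xy.
by rewrite all_rcons.
Qed.

Lemma big_ord_geq a (F : nat -> A) : (a <= N)%N -> F 0%N = 0 ->
  \sum_(b < N.+1 | geq a b) F b = \sum_(1 <= b < a.+1) F b.
Proof.
move=> aN F0.
rewrite (eq_bigl (fun b : 'I_N.+1 => (b < a.+1)%N)) //.
rewrite -(big_ord_widen N.+1 F) ?ltnS //.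
by rewrite -(big_mkord xpredT F) big_ltn // F0 add0r.
Qed.

Lemma weak_chsum_cons l a F : (a <= N)%N ->
  chsum geq 1 l.+1 a F =
  \sum_(1 <= b < a.+1) chsum geq 1 l b (fun s => F (b :: s)).
Proof.
move=> aN; rewrite chsum_cons.
rewrite (big_ord_geq (F := fun b => chsum geq 1 l b (fun s => F (b :: s)))) //.
exact: chsum_geq0.
Qed.

(** The leading x entries of a weak chain, each weighted by its inverse, amount to x
applications of geomsum 1. The entry before the remaining L ones is read off
a :: s, so that x = 0 is covered. *)
Lemma weak_block x L a (G : nat -> seq nat -> A) : (0 < a <= N)%N ->
  chsum geq 1 (x + L) a (fun s => \prod_(1 <= i < x.+1) (s`_[i])%:R^-1
                                  * G (nth 0%N (a :: s) x) (drop x s))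
  = iter x (geomsum 1) (fun b => chsum geq 1 L b (G b)) a.
Proof.
elim: x a => [|x IH] a /andP[a0 aN].
  by apply: eq_chsum => s _; rewrite big_geq // mul1r drop0.
rewrite addSn weak_chsum_cons // [RHS]/= /geomsum.
apply: eq_big_nat => b /andP[b0 ba].
rewrite expr1n mul1r -IH ?b0 ?(leq_trans _ aN) // mulrC -chsumZ.
apply: eq_chsum => s _; rewrite big_ltn // -mulrA; congr (_ * _).
congr (_ * _); rewrite big_add1 /=; apply: eq_big_nat => i /andP[i0 _].
by case: i i0.
Qed.


Lemma strict_chsum_rcons p z F :
  chsum gtn z p.+1 N.+1 F =
  \sum_(z.+1 <= b < N.+1) chsum gtn b p N.+1 (fun s => F (rcons s b)).
Proof.
rewrite chsum_rcons big_mkcond /=.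
rewrite -(big_mkord xpredT (fun b => if (z < b)%N then
  chsum gtn b p N.+1 (fun s => F (rcons s b)) else 0)).
by rewrite -big_mkcond [RHS](big_nat_widenl _ 0).
Qed.

End ChainSums.

(** * Star sums *)

Section Star.
Variables (A : comUnitRingType) (N : nat) (t : nat -> A) (k : seq nat).

(** The summand of the weak chain sums over an arbitrary ring, with 1/n written as
an inverse of that ring. *)
Definition star (m q : nat) (n : seq nat) : A :=
  (\prod_(1 <= i < q)
     (1 - t (m.+1 - i)) ^+ (n`_[lpart m k i] - n`_[(lpart m k i).+1]))
  * ((1 - t (m.+1 - q)) ^+ n`_[lpart m k q] - 1)
  * \prod_(1 <= i < (lpart m k q).+1) (n`_[i])%:R^-1.

Lemma lpart0 m : lpart m k 0 = 0%N.
Proof. by rewrite /lpart big_geq. Qed.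

Lemma lpartS m q : lpart m.+1 k q.+1 = (k`_[m.+1] + lpart m k q)%N.
Proof. by rewrite /lpart big_ltn // big_add1. Qed.

Lemma lpart_gt0 m q : (forall i, (0 < i <= m)%N -> (0 < k`_[i])%N) ->
  (0 < q <= m)%N -> (0 < lpart m k q)%N.
Proof.
case: q m => // q [|m] // k0 _; rewrite lpartS addn_gt0 k0 //.
by rewrite ltnSn.
Qed.

Lemma ent_drop x s i : (0 < i)%N -> (drop x s)`_[i] = s`_[x + i].
Proof. by case: i => // i _; rewrite /ent nth_drop addnS. Qed.

(** What remains of star once its first block, ending with the entry b, is
removed: the step from b to the next block and the star of the other blocks, or
only the closing factor if the first block was the last. *)
Definition startail (m q b : nat) (s : seq nat) : A :=
  if q is _.+1 then (1 - t m) ^+ (b - s`_[1]) * star m.-1 q s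
  else (1 - t m) ^+ b - 1.

Lemma star_split m q s : (forall i, (0 < i <= m.+1)%N -> (0 < k`_[i])%N) ->
  (q <= m)%N ->
  star m.+1 q.+1 s = \prod_(1 <= i < k`_[m.+1].+1) (s`_[i])%:R^-1
     * startail m.+1 q s`_[k`_[m.+1]] (drop k`_[m.+1] s).
Proof.
move=> k0 qm; rewrite /star !lpartS subSS.
set x := k`_[m.+1].
have lp i : (0 < i)%N -> (i <= q)%N -> (0 < lpart m k i)%N.
  move=> i0 iq; apply: lpart_gt0; last by rewrite i0 (leq_trans iq).
  by move=> j /andP[j0 jm]; rewrite k0 // j0 (leq_trans jm).
rewrite [RHS]mulrC.
rewrite [X in _ * X = _](big_cat_nat (n := x.+1)) //=; last first.
  by rewrite ltnS leq_addr.
rewrite mulrCA [RHS]mulrC; congr (_ * _).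
case: q qm lp => [|q] qm lp /=.
  by rewrite lpart0 addn0 !big_geq // mul1r mulr1 subn0.
rewrite big_ltn // lpartS lpart0 addn0 subn1 /= -!mulrA; congr (_ * _).
  by rewrite ent_drop // addn1.
rewrite mulrA /star; congr (_ * _ * _).
- rewrite big_add1 /=; apply: eq_big_nat => i /andP[i0 iq].
  rewrite subSS lpartS -addnS !ent_drop //.
  exact/lp/ltnW.
- by rewrite ent_drop // lp.
- rewrite -{1}[x.+1]add1n big_addn -addnS addKn.
  by apply: eq_big_nat => i /andP[i0 _]; rewrite ent_drop // addnC.
Qed.

Definition star_density (q m : nat) : nat -> A := 
  nest k 1 (fun i => 1 - t i) (fun c n => c ^+ n - 1) q m.

Lemma star_chsum_block m q a (psi : nat -> A) :
  (forall i, (0 < i <= m.+1)%N -> (0 < k`_[i])%N) -> (q <= m)%N ->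
  (0 < a <= N)%N ->
  chsum N geq 1 (lpart m.+1 k q.+1) a (fun s => psi s`_[1] * star m.+1 q.+1 s)
  = \sum_(1 <= d < a.+1) psi d * (iter (k`_[m.+1]).-1 (geomsum 1)
      (fun b => chsum N geq 1 (lpart m k q) b (startail m.+1 q b)) d / d%:R).
Proof.
move=> k0 qm /andP[a0 aN].
have km0 : (0 < k`_[m.+1])%N by rewrite k0 ?ltnSn.
rewrite lpartS -(prednK km0) addSn weak_chsum_cons //.
apply: eq_big_nat => d /andP[d0]; rewrite ltnS => da; have dN := leq_trans da aN.
rewrite -weak_block ?d0 // [_ / _]mulrC mulrA -chsumZ.
apply: eq_chsum => s _; rewrite star_split // -(prednK km0) /=.
rewrite big_ltn // -!mulrA; congr (_ * (_ * (_ * _))).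
by rewrite big_add1 /=; apply: eq_big_nat => i /andP[i0 _]; case: i i0.
Qed.

(** The weight psi is kept arbitrary because the induction on the number of blocks
needs psi(n) = (1 - t)^(b - n), where b ends the preceding block. *)
Lemma star_chsum m q a (psi : nat -> A) :
  (forall i, (0 < i <= m)%N -> (0 < k`_[i])%N) -> (q < m)%N -> (0 < a <= N)%N ->
  chsum N geq 1 (lpart m k q.+1) a (fun s => psi s`_[1] * star m q.+1 s)
  = \sum_(1 <= d < a.+1) psi d * (star_density q m d / d%:R).
Proof.
have eq_iter (x d : nat) (f g : nat -> A) : (0 < d <= N)%N ->
    (forall b, (0 < b <= N)%N -> f b = g b) ->
    iter x (geomsum 1) f d = iter x (geomsum 1) g d.
  move=> + fg; elim: x d => [|x IHx] d /andP[d0 dN] /=; first by rewrite fg ?d0.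
  by apply: eq_geomsum => b /andP[b0 bd]; rewrite IHx // b0 (leq_trans bd).
elim: q m a psi => [|q IH] [|m] // a psi k0 qm /andP[a0 aN].
all: rewrite star_chsum_block ?a0 //.
all: apply: eq_big_nat => d /andP[d0]; rewrite ltnS => da; have dN := leq_trans da aN.
all: congr (_ * (_ / _)); apply: eq_iter; rewrite ?d0 // => b /andP[b0 bN].
- by rewrite lpart0 chsum0 /geq /= b0.
rewrite (IH m b (fun e => (1 - t m.+1) ^+ (b - e))) ?b0 // => i /andP[i0 im].
by rewrite k0 // i0 leqW.
Qed.

End Star.

(** * Strict chains *)

Section Strict.
Variables (A : comUnitRingType) (N : nat) (t : nat -> A) (k : seq nat).

Definition ratio (n i : nat) : A := (t i / t i.+1) ^+ n / (n ^ k`_[i])%:R.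

Definition strict (p z : nat) : A :=
  chsum N gtn z p N.+1 (fun s => \prod_(1 <= i < p.+1) ratio s`_[i] i).

Lemma strict0 z : (z <= N)%N -> strict 0 z = 1.
Proof. by move=> zN; rewrite /strict chsum0 /= ltnS zN big_geq. Qed.

(** Only the last factor is singled out: peeling strict chains at the lower end
keeps the inner sums of the form strict p b. *)
Lemma chsum_last p z (F : seq nat -> A) (h : nat -> A) :
  (forall s b, size s = p ->
     F (rcons s b) = h b * \prod_(1 <= i < p.+1) ratio s`_[i] i) ->
  chsum N gtn z p.+1 N.+1 F = \sum_(z.+1 <= b < N.+1) h b * strict p b.
Proof.
move=> Fh; rewrite strict_chsum_rcons; apply: eq_bigr => b _.
by rewrite -chsumZ; apply: eq_chsum => s; apply: Fh.
Qed.

Lemma ent_rcons s b p i : size s = p -> (0 < i <= p)%N ->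
  (rcons s b)`_[i] = s`_[i].
Proof. by move=> sp; case: i => // i /andP[_ ip]; rewrite /ent nth_rcons sp ip. Qed.

Lemma ent_last s b p : size s = p -> (rcons s b)`_[p.+1] = b.
Proof. by move=> sp; rewrite /ent nth_rcons sp ltnn eqxx. Qed.

Lemma strictS p z : strict p.+1 z =
  \sum_(z.+1 <= b < N.+1) ratio b p.+1 * strict p b.
Proof.
apply: chsum_last => s b sp.
rewrite big_nat_recr //= (ent_last _ sp) mulrC; congr (_ * _).
by apply: eq_big_nat => i ip; rewrite (ent_rcons _ sp).
Qed.

Lemma strict_compl p z : (z <= N)%N ->
  strict p.+1 z = strict p.+1 0 - \sum_(1 <= r < z.+1) ratio r p.+1 * strict p r.
Proof.
move=> zN.
by rewrite !strictS [in RHS](big_cat_nat (n := z.+1)) //=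
  addrAC subrr add0r.
Qed.

(** The nest dual to star_density; its inner steps have weight 0, so that each block
has only one free index. *)
Definition pow_density (q m : nat) : nat -> A :=
  nest k 0 t (fun c n => c ^+ n) q m.

Hypothesis natU : forall n, (0 < n)%N -> (n%:R : A) \is a GRing.unit.

Lemma iter_geomsum0 x (f : nat -> A) n : (0 < n)%N ->
  iter x (geomsum 0) f n = f n / (n ^ x)%:R.
Proof.
move=> n0; elim: x => [|x IHx] /=; first by rewrite expn0 divr1.
rewrite geomsum_0 // IHx -mulrA expnS natrM invrM ?natU ?expn_gt0 ?n0 //.
Qed.

Lemma pow_density_div q m n : (0 < n)%N -> (0 < k`_[m])%N ->
  pow_density q m n / n%:R =
    (if q is q'.+1 then geomsum (t m) (pow_density q' m.-1) n else t m ^+ n)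
    / (n ^ k`_[m])%:R.
Proof.
move=> n0 km0; have nU := natU n0.
have -> : ((n ^ k`_[m])%:R : A)^-1 = (n ^ (k`_[m]).-1)%:R^-1 / n%:R.
  by rewrite -invrM ?natU ?expn_gt0 ?n0 // -natrM -expnS prednK.
by rewrite /pow_density; case: q => [|q] /=; rewrite mulrA iter_geomsum0.
Qed.

(** Induction on p through strict_compl. The term j = p + 1 is strict (p + 1) 0; in
the others the factor (t_(p+1) / t_(p+2))^r of the subtracted sum meets
t_(p+2)^n, which turns the expansion for p, evaluated at r, into one more
geomsum with ratio t_(p+2). *)
Lemma strict_pow_density p n :
  (forall i, (1 < i <= p.+1)%N -> t i \is a GRing.unit) ->
  (forall i, (0 < i <= p.+1)%N -> (0 < k`_[i])%N) -> (0 < n <= N)%N ->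
  strict p n * (t p.+1 ^+ n / (n ^ k`_[p.+1])%:R)
  = \sum_(j < p.+1) (-1) ^+ (p - j) * strict j 0
       * (pow_density (p - j) p.+1 n / n%:R).
Proof.
elim: p n => [|p IH] n tU k0 /andP[n0 nN].
  by rewrite big_ord1 pow_density_div ?k0 // !strict0 // !mul1r.
rewrite strict_compl // big_ord_recr /= subnn expr0 mul1r.
rewrite pow_density_div ?k0 ?ltnSn //.
rewrite mulrBl addrC; congr (_ + _); rewrite mulr_suml -sumrN.
transitivity (\sum_(1 <= r < n.+1) \sum_(j < p.+1) - ((-1) ^+ (p - j)
    * strict j 0 * (t p.+2 ^+ (n - r) * (pow_density (p - j) p.+1 r / r%:R))
    / (n ^ k`_[p.+2])%:R)).
  apply: eq_big_nat => r /andP[r0]; rewrite ltnS => rn.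
  have tpU : t p.+2 \is a GRing.unit by rewrite tU ?ltnSn.
  rewrite sumrN; congr (- _).
  have -> : ratio r p.+1 * strict p r
      = t p.+2 ^- r * (strict p r * (t p.+1 ^+ r / (r ^ k`_[p.+1])%:R)).
    rewrite /ratio expr_div_n.
    by rewrite -!mulrA mulrCA; congr (_ * _); rewrite [RHS]mulrC -mulrA.
  rewrite IH ?r0 ?(leq_trans rn) //; last first.
  - by move=> i /andP[i0 ip]; rewrite k0 // i0 leqW.
  - by move=> i /andP[i0 ip]; rewrite tU // i0 leqW.
  rewrite mulr_sumr mulr_suml; apply: eq_bigr => j _.
  have -> : t p.+2 ^+ (n - r) = t p.+2 ^- r * t p.+2 ^+ n.
    by rewrite -{2}(subnK rn) exprD mulrCA mulVr ?unitrX // mulr1.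
  rewrite -!mulrA mulrCA; congr (_ * _); rewrite mulrCA; congr (_ * _).
  by congr (_ * _); rewrite [RHS]mulrCA; congr (_ * _); rewrite mulrCA.
rewrite exchange_big /=; apply: eq_bigr => j _.
have jp : (j <= p)%N by rewrite -ltnS.
rewrite pow_density_div ?k0 ?ltnSn // subSn // exprS !mulN1r !mulNr sumrN.
congr (- _); rewrite mulrA -mulr_suml; congr (_ / _).
by rewrite -mulr_sumr.
Qed.

End Strict.

(** * Expansion of strict chain sums by weak ones *)

Section Identities.
Variables (A : comUnitRingType) (N m : nat) (t : nat -> A) (k : seq nat).
Hypothesis natU : forall n, (0 < n)%N -> (n%:R : A) \is a GRing.unit.
Hypothesis tU : forall i, (1 < i <= m.+1)%N -> t i \is a GRing.unit.
Hypothesis k0 : forall i, (0 < i <= m.+1)%N -> (0 < k`_[i])%N.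
Hypothesis N0 : (0 < N)%N.

Lemma pow_star_dual q l : bin_dual (pow_density t k q l) (star_density t k q l).
Proof.
apply: dual_nest => // [|i|c d cd]; rewrite ?add0r //; first by rewrite addrC subrK.
exact: dual_expr.
Qed.

Lemma star_pow_dual q l : bin_dual (star_density t k q l) (pow_density t k q l).
Proof.
apply: dual_nest => // [|i|c d cd]; rewrite ?addr0 ?subrK //.
exact: dual_exprB1.
Qed.

Lemma strict_expand (phi : nat -> A) (F : seq nat -> A) :
  (forall s b, size s = m -> F (rcons s b) =
    phi b * (t m.+1 ^+ b / (b ^ k`_[m.+1])%:R)
    * \prod_(1 <= i < m.+1) ratio t k s`_[i] i) ->
  chsum N gtn 0 m.+1 N.+1 F =
  \sum_(j < m.+1) (-1) ^+ (m - j) * strict N t k j 0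
     * \sum_(1 <= n < N.+1) phi n * (pow_density t k (m - j) m.+1 n / n%:R).
Proof.
move=> Fphi; rewrite (chsum_last N _ Fphi).
transitivity (\sum_(1 <= n < N.+1) \sum_(j < m.+1) (-1) ^+ (m - j)
   * strict N t k j 0 * (phi n * (pow_density t k (m - j) m.+1 n / n%:R))).
  apply: eq_big_nat => n nN.
  rewrite -mulrA [_ * strict _ _ _ _ _]mulrC strict_pow_density // mulr_sumr.
  by apply: eq_bigr => j _; rewrite mulrCA.
by rewrite exchange_big /=; apply: eq_bigr => j _; rewrite -mulr_sumr.
Qed.

(** The term j = 0 stands apart because its strict factor is an empty product. *)
Lemma split_j0 (S : nat -> A) :
  \sum_(j < m.+1) (-1) ^+ (m - j) * strict N t k j 0 * S (m - j)%N
  = (-1) ^+ m * S m + \sum_(1 <= j < m.+1) (-1) ^+ (m.+1 - j).-1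
      * strict N t k j 0 * S (m.+1 - j).-1.
Proof.
rewrite -(big_mkord xpredT (fun j => (-1) ^+ (m - j) * strict N t k j 0 * S (m - j)%N)).
rewrite big_ltn // subn0 strict0 // mulr1; congr (_ + _).
by apply: eq_big_nat => j /andP[j0 jm]; rewrite -subn1 subnAC subn1.
Qed.

(** Everything but the two end weights phi and psi is common to both parts of
the theorem: phi sits on the smallest index of the strict chains, psi on the
largest index of the weak chains, and the only link needed between them is that
they pair equally with dual sequences. *)
Lemma chain_identity (phi psi : nat -> A) (F : seq nat -> A) :
  (forall q, \sum_(1 <= n < N.+1) psi n * (star_density t k q m.+1 n / n%:R)
           = \sum_(1 <= n < N.+1) phi n * (pow_density t k q m.+1 n / n%:R)) ->
  (forall s b, size s = m -> F (rcons s b) =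
    phi b * (t m.+1 ^+ b / (b ^ k`_[m.+1])%:R)
    * \prod_(1 <= i < m.+1) ratio t k s`_[i] i) ->
  chsum N gtn 0 m.+1 N.+1 F
  = (-1) ^+ m * chsum N geq 1 (lpart m.+1 k m.+1) N
                  (fun s => psi s`_[1] * star t k m.+1 m.+1 s)
  + \sum_(1 <= j < m.+1) (-1) ^+ (m.+1 - j).-1 * strict N t k j 0
     * chsum N geq 1 (lpart m.+1 k (m.+1 - j)) N
         (fun s => psi s`_[1] * star t k m.+1 (m.+1 - j) s).
Proof.
move=> phipsi HF; rewrite (strict_expand HF).
pose D q := \sum_(1 <= n < N.+1) phi n * (pow_density t k q m.+1 n / n%:R).
have E q : (q <= m)%N -> chsum N geq 1 (lpart m.+1 k q.+1) N
    (fun s => psi s`_[1] * star t k m.+1 q.+1 s) = D q.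
  by move=> qm; rewrite star_chsum ?N0 ?leqnn // phipsi.
rewrite [LHS](split_j0 D) -E //; congr (_ + _).
apply: eq_big_nat => j /andP[j0 jm].
by rewrite -E ?prednK ?subn_gt0 // -subn1 leq_subLR addnC addn1 leq_subr.
Qed.

End Identities.

(** * Specialization to the Laurent ring *)

Section RatScalars.
Variables (R : comAlgType rat) (m : nat).
Local Notation ratC := (ratC R m).

Lemma ratC1 : ratC 1 = 1.
Proof. by rewrite /Defs.ratC scale1r mpolyC1 lpi1. Qed.

Lemma ratCM : {morph ratC : x y / x * y}.
Proof. by move=> x y; rewrite /Defs.ratC -lpiM -mpolyCM -(rmorphM (in_alg R)). Qed.

Lemma ratCD : {morph ratC : x y / x + y}.
Proof. by move=> x y; rewrite /Defs.ratC -lpiD -mpolyCD scalerDl. Qed.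

Lemma ratC0 : ratC 0 = 0.
Proof. by apply: (addrI (ratC 0)); rewrite -ratCD !addr0. Qed.

Lemma ratC_nat n : ratC n%:R = n%:R.
Proof.
by elim: n => [|n IH]; rewrite ?ratC0 // -[n.+1]addn1 !natrD ratCD IH ratC1.
Qed.

Lemma laurent_natU n : (0 < n)%N -> (n%:R : laurent R m) \is a GRing.unit.
Proof.
move=> n0; apply/unitrPr; exists (ratC n%:R^-1).
by rewrite -ratC_nat -ratCM divff ?ratC1 // Num.Theory.pnatr_eq0 -lt0n.
Qed.

(** True also at n = 0, since a non-unit is its own inverse; hence summands can be
rewritten for every tuple, not only for chains. *)
Lemma ratC_natV n : ratC n%:R^-1 = n%:R^-1.
Proof.
case: n => [|n]; first by rewrite !invr0 ratC0.
apply: (mulrI (laurent_natU (ltn0Sn n))).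
rewrite divrr ?laurent_natU // -ratC_nat -ratCM.
by rewrite divff ?ratC1 // Num.Theory.pnatr_eq0.
Qed.

Lemma ratC_prodV a b (F : nat -> nat) :
  ratC (\prod_(a <= i < b) (F i)%:R)^-1 = \prod_(a <= i < b) (F i)%:R^-1.
Proof.
rewrite -prodfV (big_morph _ ratCM ratC1).
by apply: eq_bigr => i _; rewrite ratC_natV.
Qed.

Lemma star_termE (k n : seq nat) q :
  star_term R m k q n = star (tvar R m) k m q n.
Proof. by rewrite /star_term ratC_prodV. Qed.

Lemma ratio_termE (k n : seq nat) j :
  ratio_term R m k j n = \prod_(1 <= i < j.+1) ratio (tvar R m) k n`_[i] i.
Proof. by rewrite /ratio_term ratC_prodV -big_split. Qed.

End RatScalars.

Lemma full_term_rcons (R : comAlgType rat) m (k s : seq nat) b : size s = m ->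
  full_term R m.+1 k (rcons s b) =
  tvar R m.+1 m.+1 ^+ b / (b ^ k`_[m.+1])%:R
    * \prod_(1 <= i < m.+1) ratio (tvar R m.+1) k s`_[i] i.
Proof.
move=> sm; rewrite /full_term ratC_prodV (ent_last _ sm).
rewrite [X in _ * X = _]big_nat_recr //= (ent_last _ sm) mulrACA.
rewrite -big_split /= mulrC; congr (_ * _).
by apply: eq_big_nat => i im; rewrite (ent_rcons _ sm).
Qed.

Theorem theorem2p10 (R : comAlgType rat) (m : nat) (k : m.-tuple nat) (N : nat)
  (m_gt0 : (0 < m)%N) (k_gt0 : forall i : 'I_m, (0 < tnth k i)%N)
  (N_gt0 : (0 < N)%N) :
  (\sum_(n : m.-tuple 'I_N.+1 | strict_chain N (idx n))
      (-1) ^+ (idx n)`_[m] * 'C(N, (idx n)`_[m])%:R * full_term R m k (idx n)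
   = (-1) ^+ m.-1
     * (\sum_(n : (sumn k).-tuple 'I_N.+1 | weak_chain N (idx n))
          star_term R m k m (idx n))
   + \sum_(1 <= j < m) (-1) ^+ (m - j).-1
     * (\sum_(n : j.-tuple 'I_N.+1 | strict_chain N (idx n))
          ratio_term R m k j (idx n))
     * (\sum_(n : (lpart m k (m - j)).-tuple 'I_N.+1 | weak_chain N (idx n))
          star_term R m k (m - j) (idx n)))
  /\
  (\sum_(n : m.-tuple 'I_N.+1 | strict_chain N (idx n))
      full_term R m k (idx n)
   = (-1) ^+ m.-1
     * (\sum_(n : (sumn k).-tuple 'I_N.+1 | weak_chain N (idx n))
          (-1) ^+ (idx n)`_[1] * 'C(N, (idx n)`_[1])%:R
          * star_term R m k m (idx n))
   + \sum_(1 <= j < m) (-1) ^+ (m - j).-1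
     * (\sum_(n : j.-tuple 'I_N.+1 | strict_chain N (idx n))
          ratio_term R m k j (idx n))
     * (\sum_(n : (lpart m k (m - j)).-tuple 'I_N.+1 | weak_chain N (idx n))
          (-1) ^+ (idx n)`_[1] * 'C(N, (idx n)`_[1])%:R
          * star_term R m k (m - j) (idx n))).
Proof.
case: m k m_gt0 k_gt0 => // {}m k _ k_gt0.
pose t := tvar R m.+1.
have k0 i : (0 < i <= m.+1)%N -> (0 < k`_[i])%N.
  case: i => // i /andP[_ im]; have := k_gt0 (Ordinal im).
  by rewrite (tnth_nth 0%N).
have tU i : (1 < i <= m.+1)%N -> t i \is a GRing.unit by exact: tvar_unit.
have natU := @laurent_natU R m.+1.
rewrite -(lpart_weight k).
have starE q : star_term R m.+1 k q =1 star t k m.+1 q.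
  by move=> n; apply: star_termE.
have ratioE j : \sum_(n : j.-tuple 'I_N.+1 | strict_chain N (idx n))
    ratio_term R m.+1 k j (idx n) = strict N t k j 0.
  by apply: eq_bigr => n _; rewrite ratio_termE.
have lastE (s : seq nat) b := @full_term_rcons R m k s b.
pose sgnbin n : laurent R m.+1 := (-1) ^+ n * 'C(N, n)%:R.
pose one (n : nat) : laurent R m.+1 := 1.
split.
- have pairing q : \sum_(1 <= n < N.+1) one n * (star_density t k q m.+1 n / n%:R)
      = \sum_(1 <= n < N.+1) sgnbin n * (pow_density t k q m.+1 n / n%:R).
    rewrite -(sum_dual natU N_gt0 (pow_star_dual t k natU q m.+1)).
    by apply: eq_bigr => n _; rewrite mul1r.
  have peel s b : size s = m ->
      sgnbin (rcons s b)`_[m.+1] * full_term R m.+1 k (rcons s b)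
      = sgnbin b * (t m.+1 ^+ b / (b ^ k`_[m.+1])%:R)
        * \prod_(1 <= i < m.+1) ratio t k s`_[i] i.
    by move=> sm; rewrite lastE // (ent_last _ sm) mulrA.
  apply: (etrans (chain_identity natU tU k0 N_gt0 pairing
    (F := fun s => sgnbin s`_[m.+1] * full_term R m.+1 k s) peel)).
  congr (_ * _ + _); first by apply: eq_bigr => n _; rewrite starE mul1r.
  apply: eq_bigr => j _; rewrite ratioE; congr (_ * _).
  by apply: eq_bigr => n _; rewrite starE mul1r.
- have pairing q :
      \sum_(1 <= n < N.+1) sgnbin n * (star_density t k q m.+1 n / n%:R)
      = \sum_(1 <= n < N.+1) one n * (pow_density t k q m.+1 n / n%:R).
    rewrite -(sum_dual natU N_gt0 (star_pow_dual t k natU q m.+1)).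
    by apply: eq_bigr => n _; rewrite mul1r.
  have peel s b : size s = m -> full_term R m.+1 k (rcons s b)
      = one b * (t m.+1 ^+ b / (b ^ k`_[m.+1])%:R)
        * \prod_(1 <= i < m.+1) ratio t k s`_[i] i.
    by move=> sm; rewrite lastE // mul1r.
  apply: (etrans (chain_identity natU tU k0 N_gt0 pairing peel)).
  congr (_ * _ + _); first by apply: eq_bigr => n _; rewrite starE.
  apply: eq_bigr => j _; rewrite ratioE; congr (_ * _).
  by apply: eq_bigr => n _; rewrite starE.
Qed.
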